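(* Let $P\in\mathcal{F}^{n\times m}$ be a plant with fractional representation $P=ND^{-1}$ ($N\in\mathcal{A}^{n\times m}$, $D\in\mathcal{A}^{m\times m}$ nonsingular), and let $I\in\mathcal{I}$. Let $\Lambda_{PI}$ denote the generalized elementary factor of $P$ with respect to $I$. Then the radical of $\Lambda_{PI}$ equals the radical of the quotient ideal $((t_I):\mathfrak{t})$: $$\sqrt{\Lambda_{PI}}=\sqrt{\bigl((t_I):\mathfrak{t}\bigr)}.$$
   Context: $\mathcal{A}$ is a commutative ring with $1\neq 0$, and $\mathcal{F}$ is its total ring of fractions. $m,n$ are positive integers, and a plant is a matrix $P\in\mathcal{F}^{n\times m}$. A square matrix over $\mathcal{A}$ is nonsingular if its determinant is a nonzerodivisor of $\mathcal{A}$. Let $T=\begin{bmatrix}N\\ D\end{bmatrix}\in\mathcal{A}^{(m+n)\times m}$, where $P=ND^{-1}$. $\mathcal{I}$ is the family of all $m$-element subsets of $\{1,\dots,m+n\}$; for $I=\{i_1<\dots<i_m\}\in\mathcal{I}$, $\Delta_I$ is the $m\times(m+n)$ matrix whose $(k,i_k)$-entries are $1$ and whose other entries are $0$, and $t_I=\det(\Delta_I T)$. The full-size minor ideal is $\mathfrak{t}=\sum_{I'\in\mathcal{I}}(t_{I'})$. The generalized elementary factor of $P$ with respect to $I\in\mathcal{I}$ is the ideal $$\Lambda_{PI}=\{\lambda\in\mathcal{A} : \exists K\in\mathcal{A}^{(m+n)\times m},\ \lambda T=K\Delta_I T\}.$$ It is independent of the choice of fraction $ND^{-1}=P$. For ideals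 $\mathfrak{a},\mathfrak{b}$ of $\mathcal{A}$, $(\mathfrak{a}:\mathfrak{b})=\{f\in\mathcal{A} : f\mathfrak{b}\subset\mathfrak{a}\}$, and $\sqrt{\mathfrak{a}}$ is the radical of $\mathfrak{a}$. *)

(* Defs.v *)
From mathcomp Require Import all_boot all_order all_algebra.
From mathcomp Require Import classical_sets.

Set Implicit Arguments.
Unset Strict Implicit.
Unset Printing Implicit Defensive.

Import GRing.Theory.
Local Open Scope ring_scope.
Local Open Scope classical_set_scope.

(* In a commutative ring, [GRing.lreg d] says that d is a nonzerodivisor. *)

(* F is, through iota, a localization of A at its nonzerodivisors; this
   determines the total ring of fractions up to unique isomorphism. *)
Record is_total_fraction_ring (A : comNzRingType) (F : comUnitRingType)
    (iota : {rmorphism A -> F}) : Prop := IsTotalFractionRing {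
  tfr_inj : injective iota;
  tfr_unit : forall d : A, GRing.lreg d -> iota d \is a GRing.unit;
  tfr_frac : forall x : F, exists a d : A, GRing.lreg d /\ x = iota a / iota d
}.

Section Ideals.
Variable A : comNzRingType.

Definition principal_ideal (a : A) : set A := [set x | exists c : A, x = c * a].

Definition ideal_sum (J : finType) (a : J -> set A) : set A :=
  [set x | exists y : J -> A, (forall j, a j (y j)) /\ x = \sum_j y j].

Definition ideal_quotient (a b : set A) : set A :=
  [set f | forall x, b x -> a (f * x)].

Definition radical (a : set A) : set A :=
  [set x | exists k : nat, (0 < k)%N /\ a (x ^+ k)].

End Ideals.

Section Plants.
Variables (A : comNzRingType) (m n : nat).

Definition nonsingular (D : 'M[A]_m) : Prop := GRing.lreg (\det D).

Definition fractional_representation (F : comUnitRingType)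
    (iota : {rmorphism A -> F}) (P : 'M[F]_(n, m))
    (N : 'M[A]_(n, m)) (D : 'M[A]_m) : Prop :=
  nonsingular D /\ P = map_mx iota N *m invmx (map_mx iota D).

(* Rows of T are indexed by 'I_(n + m) rather than 'I_(m + n), so that
   T = col_mx N D is well typed. *)
Definition index_set : Type := {I : {set 'I_(n + m)} | #|I| == m}.

(* The element i_k of I = {i_0 < ... < i_(m-1)}; see index_elt_lt and
   index_elt_in below. *)
Definition index_elt (I : index_set) (k : 'I_m) : 'I_(n + m) :=
  enum_val (cast_ord (esym (eqP (valP I))) k).

Lemma index_elt_in (I : index_set) (k : 'I_m) : index_elt I k \in val I.
Proof. exact: enum_valP. Qed.

Lemma index_elt_lt (I : index_set) (k l : 'I_m) :
  (k < l)%N -> (index_elt I k < index_elt I l)%N.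
Proof.
move=> kl; rewrite /index_elt.
set k' := cast_ord _ k; set l' := cast_ord _ l.
have x0 : 'I_(n + m) by exact: (index_elt I k).
rewrite !(enum_val_nth x0).
have s : sorted (fun i j : 'I_(n + m) => (i < j)%N) (enum (val I)).
  rewrite /enum_mem; apply: sorted_filter; first by move=> a b c; apply: ltn_trans.
  have := iota_ltn_sorted 0 (n + m).
  by rewrite -val_enum_ord sorted_map enumT.
apply: (sorted_ltn_nth _ x0 s) => //; first by move=> a b c; apply: ltn_trans.
- by rewrite inE -cardE ltn_ord.
- by rewrite inE -cardE ltn_ord.
Qed.

Definition Delta (I : index_set) : 'M[A]_(m, n + m) :=
  \matrix_(k, j) (j == index_elt I k)%:R.

Definition minor (T : 'M[A]_(n + m, m)) (I : index_set) : A :=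
  \det (Delta I *m T).

Definition full_size_minor_ideal (T : 'M[A]_(n + m, m)) : set A :=
  ideal_sum (fun I : index_set => principal_ideal (minor T I)).

(* Lambda_PI, computed from the matrix T = col_mx N D of a fractional
   representation P = N D^-1. *)
Definition generalized_elementary_factor (T : 'M[A]_(n + m, m))
    (I : index_set) : set A :=
  [set lambda | exists K : 'M[A]_(n + m, m), lambda *: T = K *m (Delta I *m T)].

End Plants.

(* Main.v *)
Require Import Defs.
From mathcomp Require Import all_boot all_order all_algebra.
From mathcomp Require Import perm.
From mathcomp Require Import classical_sets.

Set Implicit Arguments.
Unset Strict Implicit.
Unset Printing Implicit Defensive.

Import GRing.Theory.
Local Open Scope ring_scope.
Local Open Scope classical_set_scope.

(** Write T_I for the square matrix Delta_I T, so that t_I = det T_I, and t for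
    the ideal of all the minors t_J.

    If lambda T = K T_I, selecting the rows in J and taking determinants gives
    lambda^m t_J = det (Delta_J K) t_I; hence lambda^m lies in ((t_I) : t)
    ([exp_factor_quotient]).

    Conversely, let f t be contained in (t_I).  By Cramer's rule every entry of
    T adj(T_I) is the determinant of T_I with one row replaced by a row of T
    ([mulmx_adj_rowsub]), hence it is zero or a minor of T up to sign
    ([det_rowsub_minor_ideal]).  So f T adj(T_I) = t_I K for some K over A, and
    multiplying by T_I on the right gives t_I (f T) = t_I (K T_I).  The minor
    t_I may be a zero divisor, so it cannot be cancelled directly.  But det D is
    itself a minor of T, so f det D = c t_I for some c; multiplying by c replaces
    the factor t_I by f det D, and det D is a nonzerodivisor.  What remains is
    f^2 T = (f K) T_I, that is, f^2 lies in Lambda_PI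
    ([sqr_quotient_factor]). *)

Section Minors.
Variables (A : comNzRingType) (m n : nat).
Implicit Types (T : 'M[A]_(n + m, m)) (I J : index_set m n).

Lemma mul_Delta (p : nat) (T : 'M[A]_(n + m, p)) I :
  Delta A I *m T = rowsub (index_elt I) T.
Proof.
apply/matrixP => k j; rewrite !mxE (bigD1 (index_elt I k)) //= !mxE eqxx mul1r.
by rewrite big1 ?addr0 // => l /negPf ne; rewrite mxE ne mul0r.
Qed.

Lemma principal_ideal_sum (a : A) (J : finType) (y : J -> A) :
  (forall j, principal_ideal a (y j)) -> principal_ideal a (\sum_j y j).
Proof.
move=> ay; apply: big_ind => [|x z [c ->] [d ->]|j _]; last exact: ay.
- by exists 0; rewrite mul0r.
- by exists (c + d); rewrite mulrDl.
Qed.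

Lemma scaled_minor_ideal T I (c : A) :
  full_size_minor_ideal T (c * minor T I).
Proof.
exists (fun J => if J == I then c * minor T J else 0); split.
  by move=> J; case: eqP => _; [exists c | exists 0; rewrite mul0r].
by rewrite -big_mkcond big_pred1_eq.
Qed.

(** The rows may be selected in any order and with repetitions: a repeated row
    makes the determinant vanish, and otherwise sorting the rows changes it by
    the sign of a permutation. *)
Lemma det_rowsub_minor_ideal T (g : 'I_m -> 'I_(n + m)) :
  full_size_minor_ideal T (\det (rowsub g T)).
Proof.
have [/injectiveP g_inj | /injectivePn [k [l kl gkl]]] := boolP (injectiveb g);
    last first.
  rewrite (determinant_alternate kl) => [|j]; last by rewrite !mxE gkl.
  exists (fun=> 0); rewrite big1 //; split=> // J.
  by exists 0; rewrite mul0r.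
have card_g : #|g @: [set: 'I_m]%SET| == m.
  by rewrite card_imset // cardsT card_ord.
pose J : index_set m n := exist _ (g @: [set: 'I_m]%SET) card_g.
(* s k is the row of T that sits at position k in g, named by its rank in J. *)
have /fin_all_exists [s gE] (k : 'I_m) : exists l, g k = index_elt J l.
  have gJ : g k \in val J by rewrite imset_f ?inE.
  exists (cast_ord (eqP (valP J)) (enum_rank_in gJ (g k))).
  by rewrite /index_elt cast_ordK enum_rankK_in.
have s_inj : injective s by move=> k l skl; apply: g_inj; rewrite !gE skl.
have -> : rowsub g T = perm_mx (perm s_inj) *m (Delta A J *m T).
  by rewrite mul_Delta -row_permE; apply/matrixP => k j; rewrite !mxE permE gE.
rewrite det_mulmx det_perm; exact: scaled_minor_ideal.
Qed.

(** Cramer's rule: expanding along row k the determinant of the matrix obtained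
    from [rowsub g T] by putting row i of T in place k. *)
Lemma mulmx_adj_rowsub T (g : 'I_m -> 'I_(n + m)) i k :
  (T *m \adj (rowsub g T)) i k =
  \det (rowsub (fun l => if l == k then i else g l) T).
Proof.
rewrite (expand_det_row _ k) !mxE; apply: eq_bigr => j _.
rewrite !mxE eqxx /cofactor; congr (_ * (_ * \det _)).
by apply/matrixP => a b; rewrite !mxE eq_sym (negPf (neq_lift _ _)).
Qed.

Lemma exp_factor_quotient T I (x : A) :
  generalized_elementary_factor T I x ->
  ideal_quotient (principal_ideal (minor T I)) (full_size_minor_ideal T)
    (x ^+ m).
Proof.
move=> [K xT] _ [y [yP ->]]; rewrite mulr_sumr; apply: principal_ideal_sum => J.
have [c ->] := yP J; exists (c * \det (Delta A J *m K)).
by rewrite mulrCA -mulrA -det_mulmx -mulmxA -xT -scalemxAr detZ.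
Qed.

(** One factor f clears the adjugate of T_I; the other trades the possible zero
    divisor t_I for the nonzerodivisor d, which may be any element of the minor
    ideal. *)
Lemma sqr_quotient_factor T I (d f : A) :
  GRing.lreg d -> full_size_minor_ideal T d ->
  ideal_quotient (principal_ideal (minor T I)) (full_size_minor_ideal T) f ->
  generalized_elementary_factor T I (f ^+ 2).
Proof.
move=> d_reg td fQ; set TI := Delta A I *m T.
have /fin_all_exists [K0 K0E] (i : 'I_(n + m)) :
    exists u : 'I_m -> A, forall k, f * (T *m \adj TI) i k = u k * minor T I.
  suff /fin_all_exists [u uE] (k : 'I_m) :
      exists c, f * (T *m \adj TI) i k = c * minor T I by exists u.
  apply: fQ; rewrite /TI mul_Delta mulmx_adj_rowsub.
  exact: det_rowsub_minor_ideal.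
pose K := \matrix_(i, k) K0 i k.
have fadj : f *: (T *m \adj TI) = minor T I *: K.
  by apply/matrixP => i k; rewrite mxE K0E !mxE mulrC.
have fT : minor T I *: (f *: T) = minor T I *: (K *m TI).
  rewrite scalemxAl -fadj -scalemxAl -mulmxA mul_adj_mx mul_mx_scalar.
  by rewrite !scalerA mulrC.
have [c fd] := fQ d td; exists (f *: K).
have cT : d *: (f ^+ 2 *: T) = d *: (f *: K *m TI).
  rewrite -scalemxAl expr2 -scalerA !(scalerA d f) (mulrC d) fd -!scalerA.
  by rewrite fT.
apply/matrixP => i j; apply: d_reg.
by move/matrixP/(_ i j): cT; rewrite !mxE.
Qed.

End Minors.

Theorem theorem6p6 (A : comNzRingType) (F : comUnitRingType)
    (iota : {rmorphism A -> F}) (hF : is_total_fraction_ring iota)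
    (m n : nat) (hm : (0 < m)%N) (hn : (0 < n)%N)
    (P : 'M[F]_(n, m)) (N : 'M[A]_(n, m)) (D : 'M[A]_m)
    (hP : fractional_representation iota P N D)
    (I : index_set m n) :
  let T := col_mx N D in
  radical (generalized_elementary_factor T I) =
  radical (ideal_quotient (principal_ideal (minor T I))
                          (full_size_minor_ideal T)).
Proof.
move=> T; have [D_reg _] := hP.
have tD : full_size_minor_ideal T (\det D).
  have <- : rowsub (@rshift n m) T = D.
    by apply/matrixP => i j; rewrite mxE col_mxEd.
  exact: det_rowsub_minor_ideal.
apply/seteqP; split=> x [k [k_gt0 xk]].
- exists (k * m)%N; rewrite muln_gt0 k_gt0 exprM; split=> //.
  exact: exp_factor_quotient.
- exists (k * 2)%N; rewrite muln_gt0 k_gt0 exprM; split=> //.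
  exact: sqr_quotient_factor D_reg tD xk.
Qed.
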